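(* Let $G$ be a finite group and let $p$ be a prime. Then $d_p(G/Z(G)) \leq \epsilon_p(G)$ and $e_p(G/Z(G)) \leq \epsilon_p(G)$.
   Context: $Z(G)$ is the center of $G$. For a finite group $H$ and a prime $p$, $d_p(H)$ denotes the derived length of a Sylow $p$-subgroup $P$ of $H$, and $e_p(H)$ is the integer such that $p^{e_p(H)}$ is the maximum order of elements of $P$. For $x\in H$, $x^H$ denotes the conjugacy class of $x$ in $H$, and $\epsilon_p(x)$ is the exponent of the largest power of $p$ dividing $|x^H|=|H:C_H(x)|$. Finally, $\epsilon_p(H)=\max\{\epsilon_p(x): x\in H\}$. *)

(* Defs.v *)
From mathcomp Require Import all_boot all_fingroup all_solvable.

Set Implicit Arguments.
Unset Strict Implicit.
Unset Printing Implicit Defensive.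

Local Open Scope group_scope.

(* Same encoding as [nil_class]: the least n with A^`(n) = 1 when A is a
   solvable group, and #|A| when A is not solvable; see [derived_length_leq]. *)
Definition derived_length (gT : finGroupType) (A : {set gT}) : nat :=
  index 1 (mkseq (fun n => A^`(n)) #|A|).

(* The next two definitions use one chosen Sylow subgroup; by [d_p_Sylow] and
   [e_p_Sylow] the choice is immaterial. *)
Definition d_p (p : nat) (gT : finGroupType) (H : {group gT}) : nat :=
  derived_length (sval (Sylow_exists p H)).

(* The base p logarithm of the maximum order, which is a power of p when p is
   prime; see [e_p_max]. *)
Definition e_p (p : nat) (gT : finGroupType) (H : {group gT}) : nat :=
  logn p (\max_(x in sval (Sylow_exists p H)) #[x])%N.

Definition epsilon_elt (p : nat) (gT : finGroupType) (H : {set gT})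
  (x : gT) : nat := logn p #|x ^: H|.

Definition epsilon_p (p : nat) (gT : finGroupType) (H : {set gT}) : nat :=
  (\max_(x in H) epsilon_elt p H x)%N.

Lemma derived_length_leq (gT : finGroupType) (G : {group gT}) (n : nat) :
  solvable G -> (derived_length G <= n)%N = (G^`(n) == 1).
Proof.
move=> solG; set s := mkseq (fun n => G^`(n)) #|G|.
have bound m : G^`(m) = 1 \/ (#|G^`(m)| + m <= #|G|)%N.
  elim: m => [|m [IH|IH]]; first by right; rewrite addn0.
    by left; apply/trivgP; rewrite -IH der_subS.
  have [E|nt] := eqVneq (G^`(m)) 1.
    by left; apply/trivgP; rewrite -E der_subS.
  right; rewrite addnS -addSn; apply: leq_trans IH.
  apply: leq_add => //; rewrite dergSn proper_card //.
  by apply: (sol_der1_proper solG) => //; apply: der_sub.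
have last1 : G^`(#|G|.-1) = 1.
  case: (bound #|G|.-1) => //.
  rewrite -[X in (_ <= X)%N](prednK (cardG_gt0 G)) -add1n leq_add2r => le1.
  by apply/card_le1_trivg.
have lt_last : (#|G|.-1 < #|G|)%N by rewrite prednK ?cardG_gt0.
have in_s : 1 \in s.
  by apply/(nthP 1); exists #|G|.-1; rewrite ?size_mkseq // nth_mkseq.
have lt_dl : (derived_length G < #|G|)%N.
  by rewrite -[X in (_ < X)%N](size_mkseq (fun n => G^`(n))) index_mem.
apply/idP/eqP => [le_n | Gn1].
  apply/trivgP.
  have <- : G^`(derived_length G) = 1.
    by rewrite -[RHS](nth_index 1 in_s) nth_mkseq.
  rewrite -(subnKC le_n); elim: (n - _)%N => [|k IH]; first by rewrite addn0.
  by rewrite addnS; apply: subset_trans IH; apply: der_subS.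
rewrite leqNgt; apply/negP => lt_n.
have := before_find 1 lt_n; rewrite nth_mkseq; last exact: ltn_trans lt_dl.
by rewrite /= Gn1 eqxx.
Qed.

Lemma d_p_Sylow (p : nat) (gT : finGroupType) (H P : {group gT}) :
  p.-Sylow(H) P -> d_p p H = derived_length P.
Proof.
move=> sylP; rewrite /d_p; case: (Sylow_exists p H) => Q sylQ /=.
have [x _ eP] := Sylow_trans sylQ sylP.
have solP : solvable P by apply: pgroup_sol (pHall_pgroup sylP).
have solQ : solvable Q by apply: pgroup_sol (pHall_pgroup sylQ).
have eq_le n : (derived_length Q <= n)%N = (derived_length P <= n)%N.
  rewrite (derived_length_leq n solQ) (derived_length_leq n solP) eP.
  by rewrite (derJ Q) -(inj_eq (@conjsg_inj _ x)) conjs1g.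
by apply/eqP; rewrite eqn_leq eq_le leqnn -eq_le leqnn.
Qed.

Lemma e_p_Sylow (p : nat) (gT : finGroupType) (H P : {group gT}) :
  p.-Sylow(H) P -> e_p p H = logn p (\max_(x in P) #[x])%N.
Proof.
move=> sylP; rewrite /e_p; case: (Sylow_exists p H) => Q sylQ /=.
have [x _ ->] := Sylow_trans sylQ sylP; congr logn.
rewrite [RHS](reindex_inj (conjg_inj x)) /=.
by apply: eq_big => y; rewrite ?memJ_conjg ?orderJ.
Qed.

Lemma e_p_max (p : nat) (gT : finGroupType) (H P : {group gT}) :
  prime p -> p.-Sylow(H) P -> (p ^ e_p p H = \max_(x in P) #[x])%N.
Proof.
move=> p_pr sylP; rewrite (e_p_Sylow sylP).
have [x Px ->] := @eq_bigmax_cond _ (mem P) (@order gT) (cardG_gt0 P).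
have := mem_p_elt (pHall_pgroup sylP) Px; rewrite /p_elt => p_x.
by rewrite -p_part part_pnat_id.
Qed.

(* Main.v *)
(* Every g in G has a conjugate y whose centraliser in a fixed Sylow
   p-subgroup P has index at most p^e, where e = epsilon_p(G), because a Sylow
   p-subgroup of C_G(g) can be conjugated into P.  A subgroup of index at most
   p^e in a p-group P contains both P^(e) and every x^(p^e), as one sees by
   going down through maximal subgroups.  So the centralisers of P^(e) and of
   x^(p^e) meet all conjugacy classes of G; since the conjugates of a proper
   subgroup do not cover a finite group, P^(e) and x^(p^e) are central. *)

Require Import Defs.
From mathcomp Require Import all_boot all_fingroup all_solvable.

Set Implicit Arguments.
Unset Strict Implicit.
Unset Printing Implicit Defensive.

Local Open Scope group_scope.

(** At most [#|G : H|] conjugates of [H^#] cover [G^#], so [#|G| - 1 <= #|G : H| * (#|H| - 1) = #|G|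
    - #|G : H|], which forces index 1. *)
Lemma conjugates_cover_eq (gT : finGroupType) (G H : {group gT}) :
  H \subset G -> (forall g, g \in G -> exists2 x, x \in G & g ^ x \in H) ->
  H :=: G.
Proof.
move=> sHG meetH; apply/eqP; rewrite eqEsubset sHG /= -indexg_eq1 eqn_leq.
rewrite indexg_gt0 andbT.
have sGD : G^# \subset cover (H^# :^: G).
  apply/subsetP=> g /setD1P[nt_g Gg]; have [x Gx Hgx] := meetH g Gg.
  apply/bigcupP; exists (H^# :^ x^-1); first by rewrite imset_f ?groupV.
  by rewrite mem_conjgV !inE conjg_eq1 nt_g.
have card_conj B : B \in H^# :^: G -> #|B| = #|H|.-1.
  by case/imsetP=> x _ ->; rewrite cardJg [in RHS](cardsD1 1) group1.
have le_conj : #|H^# :^: G| <= #|G : H|.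
  rewrite card_conjugates normD1 dvdn_leq ?indexgS //.
  by rewrite subsetI sHG normG.
have := leq_trans (subset_leq_card sGD) (leq_card_cover _).
rewrite (eq_bigr _ card_conj) sum_nat_const => le_G.
have {le_G} := leq_trans le_G (leq_mul le_conj (leqnn _)).
have -> : #|G^#| = #|G|.-1 by rewrite [in RHS](cardsD1 1) group1.
rewrite -(Lagrange sHG); case: #|H| (cardG_gt0 H) => // h _ /=.
case: #|G : H| (indexg_gt0 G H) => // i _.
rewrite mulSn addSn /= mulnC -[X in _ <= X]add0n leq_add2r leqn0.
by move/eqP->.
Qed.

(** Induction step for the next two lemmas: passing from [P] to [M] lowers the exponent of the index
    of [K] by one. *)
Lemma pgroup_maximal_over (gT : finGroupType) (p : nat) (P K : {group gT}) :
    prime p -> p.-group P -> K \subset P ->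
  K :=: P \/
  exists M : {group gT},
    [/\ K \subset M, M <| P, #|P : M| = p
      & logn p #|P : K| = (logn p #|M : K|).+1].
Proof.
move=> p_pr pP sKP; case: (maximal_exists sKP) => [|[M maxM sKM]]; first by left.
right; exists M; have nsMP := p_maximal_normal pP maxM.
have iM := p_maximal_index pP maxM; split=> //.
rewrite -(Lagrange_index (normal_sub nsMP) sKM) iM.
by rewrite lognM ?indexg_gt0 ?prime_gt0 // logn_prime // eqxx.
Qed.

Lemma der_sub_logn_index (gT : finGroupType) (p n : nat) (P K : {group gT}) :
    prime p -> p.-group P -> K \subset P -> logn p #|P : K| <= n ->
  P^`(n) \subset K.
Proof.
move=> p_pr; elim: n P => [|n IHn] P pP sKP;
  have [-> _|[M [sKM nsMP iM ->]]] := pgroup_maximal_over p_pr pP sKP;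
  rewrite ?der_sub // ltnS => le_n.
have [sMP nMP] := andP nsMP.
apply: subset_trans (IHn M (pgroupS sMP pP) sKM le_n).
(* [P / M] has order [p], hence is abelian; deriving this inclusion [n] more times finishes the
   proof. *)
have sP'M : P^`(1) \subset M.
  apply: der1_min (normal_norm nsMP) (cyclic_abelian (prime_cyclic _)).
  by rewrite card_quotient ?iM.
by elim: n {IHn le_n} => // n IHn; rewrite !(dergSn n.+1, dergSn n) commgSS.
Qed.

Lemma expg_mem_logn_index (gT : finGroupType) (p n : nat) (P K : {group gT}) x :
    prime p -> p.-group P -> K \subset P -> logn p #|P : K| <= n ->
  x \in P -> x ^+ (p ^ n) \in K.
Proof.
move=> p_pr; elim: n P x => [|n IHn] P x pP sKP le_n Px;
  (have [->|[M [sKM nsMP iM iK]]] := pgroup_maximal_over p_pr pP sKP;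
    first by rewrite groupX);
  rewrite iK // ltnS in le_n.
have [sMP nMP] := andP nsMP; have Nx := subsetP nMP x Px.
(* The induction hypothesis is applied to [x ^+ p], which lies in [M] because [P / M] has order
   [p]. *)
rewrite expnS expgM (IHn M) ?(pgroupS sMP pP) //.
rewrite coset_idr ?groupX // morphX //; apply/eqP.
by rewrite -order_dvdn -iM -card_quotient // order_dvdG ?mem_quotient.
Qed.

(** Common end of both bounds: [A] will be a term of the derived series of [P], then a singleton. *)
Lemma central_of_logn_index (gT : finGroupType) (p : nat) (G P : {group gT})
    (A : {set gT}) :
    p.-Sylow(G) P -> A \subset G ->
    (forall K : {group gT}, K \subset P ->
       logn p #|P : K| <= epsilon_p p G -> A \subset K) ->
  A \subset 'Z(G).
Proof.
move=> sylP sAG subK; rewrite subsetI sAG centsC.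
suff <- : 'C_G(A) = G by apply: subsetIr.
apply: conjugates_cover_eq (subsetIl _ _) _ => g Gg.
have [Q sylQ] := Sylow_exists p 'C_G[g].
have [sQC pQ _] := and3P sylQ; have [sQG cQg] := subsetIP sQC.
have [x Gx sQP] := Sylow_Jsub sylP sQG pQ.
exists x => //; rewrite inE groupJ // -sub1set centsC cent_set1.
have sAQ : A \subset (Q :^ x)%G.
  apply: (subK _ sQP).
  have le_g : logn p #|g ^: G| <= epsilon_p p G.
    exact: (leq_bigmax_cond (F := epsilon_elt p G)) Gg.
  apply: leq_trans le_g.
  (* As [P] and [Q] are Sylow in [G] and ['C_G[g]], the index of [Q :^ x] in [P] is the [p]-part of
     the size of the class of [g]. *)
  rewrite -divgS // /= cardJg (card_Hall sylP) (card_Hall sylQ) -index_cent1.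
  rewrite -divgS ?subsetIl // !logn_div ?cardSg ?subsetIl ?logn_part //.
  by rewrite partn_dvd ?cardG_gt0 // cardSg ?subsetIl.
apply: subset_trans sAQ _.
by rewrite /= cent1J conjSg.
Qed.

Theorem corollary1p2 (gT : finGroupType) (G : {group gT}) (p : nat)
    (p_prime : prime p) :
  (d_p p (G / 'Z(G))%G <= epsilon_p p G)%N /\
  (e_p p (G / 'Z(G))%G <= epsilon_p p G)%N.
Proof.
have [P sylP] := Sylow_exists p G.
have [sPG pP _] := and3P sylP.
have nZP := subset_trans sPG (normal_norm (center_normal G)).
have sylPZ : p.-Sylow(G / 'Z(G)) (P / 'Z(G)) := quotient_pHall nZP sylP.
have pPZ := pHall_pgroup sylPZ; split.
  rewrite (d_p_Sylow sylPZ) (derived_length_leq _ (pgroup_sol pPZ)) /=.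
  rewrite -quotient_der // -subG1.
  rewrite quotient_sub1 ?(subset_trans (der_sub _ _) nZP) //.
  apply: (central_of_logn_index sylP) => [|K sKP le_K].
    exact: subset_trans (der_sub _ _) sPG.
  exact: der_sub_logn_index le_K.
(* Exponentiating replaces [e_p] by a maximum of element orders, so each order can be bounded
   separately. *)
rewrite -(leq_exp2l _ _ (prime_gt1 p_prime)) (e_p_max p_prime sylPZ).
apply/bigmax_leqP=> _ /morphimP[x Nx Px ->].
rewrite dvdn_leq ?expn_gt0 ?prime_gt0 // order_dvdn -morphX //.
rewrite /= coset_id // -sub1set.
have Gx := subsetP sPG x Px.
apply: (central_of_logn_index sylP) => [|K sKP le_K].
  by rewrite sub1set groupX.
by rewrite sub1set (expg_mem_logn_index p_prime pP).
Qed.
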